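(* Let $M$ be an abelian group and let $B_1 \subseteq B_2 \subseteq M$ be structuring elements. Then $B_1 \subseteq_{S,M} B_2$ if and only if there are finitely many $v_1, \dots, v_n \in M$ such that $$B_2 = B_1 \cup \left( \bigcup_{i=1}^n (B_1 + v_i) \right).$$
   Context: A structuring element is a finite set $B$ with $0 \in B \subseteq M$. For $A \subseteq M$ and $v \in M$, $A + v = \{a + v : a \in A\}$. With pixel set $P = M$, the shift inclusion $B_1 \subseteq_{S,M} B_2$ means: $B_1 \subseteq B_2$ and for every $b_2 \in B_2$ there exists $b_1 \in B_1$ such that $B_1 + (b_2 - b_1) \subseteq B_2$. (In general, for a pixel set $P \subseteq M$, $B_1 \subseteq_{S,P} B_2$ means $B_1 \subseteq B_2$ and: for all $x \in P$ and $b_2 \in B_2$ with $x + b_2 \in P$ there is $b_1 \in B_1$ with $x + b_1 \in P$ and $B_1 + (b_2 - b_1) \subseteq B_2$; and for all $x \in P$ and $b_2 \in B_2$ with $x - b_2 \in P$ there is $b_1 \in B_1$ with $x - b_1 \in P$ and $B_1 + (b_2 - b_1) \subseteq B_2$. For $P = M$ this reduces to the condition above.) *)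

(* Defs.v *)
From HB Require Import structures.
From mathcomp Require Import all_boot all_order all_algebra.
From mathcomp Require Import all_classical.

Set Implicit Arguments.
Unset Strict Implicit.
Unset Printing Implicit Defensive.

Import GRing.Theory.

Local Open Scope classical_set_scope.
Local Open Scope ring_scope.

Definition structuring_element (M : zmodType) (B : set M) : Prop :=
  finite_set B /\ B 0.

Definition translate (M : zmodType) (A : set M) (v : M) : set M :=
  [set a + v | a in A].

Definition shift_incl (M : zmodType) (P B1 B2 : set M) : Prop :=
  [/\ B1 `<=` B2,
      forall x b2 : M, P x -> B2 b2 -> P (x + b2) ->
        exists b1 : M,
          [/\ B1 b1, P (x + b1) & translate B1 (b2 - b1) `<=` B2]
    & forall x b2 : M, P x -> B2 b2 -> P (x - b2) ->
        exists b1 : M,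
          [/\ B1 b1, P (x - b1) & translate B1 (b2 - b1) `<=` B2]].

(* Main.v *)
(** The translation vectors are all [v] with [B1 + v] inside [B2]; they form a
    finite set because [0] lies in [B1], which puts each such [v] in [B2]. *)
Require Import Defs.
From mathcomp Require Import all_boot all_order all_algebra.
From mathcomp Require Import all_classical.

Import GRing.Theory.

Local Open Scope classical_set_scope.
Local Open Scope ring_scope.

(** For [P = M] the conditions on [x] are vacuous ([shift_incl_setTP]). As [b2 = b1 + (b2 - b1)],
    shift inclusion then says that every point of [B2] lies in a translate of [B1] contained in
    [B2], so [B2] is the union of these translates, finite in number by
    [finite_translates_subset]. *)

Lemma shift_incl_setTP (M : zmodType) (B1 B2 : set M) :
  shift_incl [set: M] B1 B2 <->
  B1 `<=` B2 /\ forall b2, B2 b2 ->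
    exists2 b1, B1 b1 & translate B1 (b2 - b1) `<=` B2.
Proof.
split=> [[sB12 shiftD _]|[sB12 shift]].
  split=> // b2 /(shiftD 0 b2 I)/(_ I)[b1 [B1b1 _ sub]].
  by exists b1.
by split=> // x b2 _ /shift[b1 B1b1 sub] _; exists b1.
Qed.

Lemma finite_translates_subset (M : zmodType) (B1 B2 : set M) :
  B1 0 -> finite_set B2 -> finite_set [set v | translate B1 v `<=` B2].
Proof.
move=> B10; apply: sub_finite_set => v /= sub.
by apply: sub; exists 0; rewrite ?add0r.
Qed.

Theorem theorem3 (M : zmodType) (B1 B2 : set M)
    (hB1 : structuring_element B1) (hB2 : structuring_element B2)
    (hB12 : B1 `<=` B2) :
  shift_incl [set: M] B1 B2 <->
  exists (n : nat) (v : 'I_n -> M),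
    B2 = B1 `|` \bigcup_(i in [set: 'I_n]) translate B1 (v i).
Proof.
case: hB1 hB2 => _ B10 [finB2 _].
rewrite shift_incl_setTP; split=> [[_ shift]|[n [v defB2]]].
  have /finite_seqP[s defs] := finite_translates_subset _ _ _ B10 finB2.
  have sP u : translate B1 u `<=` B2 <-> u \in s.
    by rewrite -[_ `<=` _]/([set u | translate B1 u `<=` B2] u) defs.
  exists (size s), (fun i => s`_i); apply/seteqP; split=> [b2 /shift|].
    move=> [b1 B1b1 /sP us]; right.
    (* The translate covering [b2] is the one by [b2 - b1], found in [s] at its index. *)
    have ltus : (index (b2 - b1)%R s < size s)%N by rewrite index_mem.
    exists (Ordinal ltus) => //; exists b1 => //=.
    by rewrite nth_index // addrC subrK.
  rewrite classical_sets.subUset; split=> //; apply: bigcup_sub => i _.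
  by apply/sP; rewrite mem_nth.
split=> // b2; rewrite {1}defB2 => -[B1b2|[i _ [b1 B1b1 <-]]].
  (* A point of [B1] is its own [b1]: the shift is zero. *)
  by exists b2 => // _ [a B1a <-]; rewrite subrr addr0; apply: hB12.
(* For [b2 = b1 + v i] the shift [b2 - b1] is [v i] itself. *)
exists b1 => //; rewrite [b1 + _]addrC addrK defB2.
by move=> x B1x; right; exists i.
Qed.
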